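(* Let $n,v,k$ be positive integers with $v\ge 2$ and $k\le v$, put $w=e^{2\pi\sqrt{-1}/n}$, and let $\lambda=\frac{k(k-1)}{v-1}$. Suppose there is a commutative association scheme whose adjacency matrices and primitive idempotents can be labelled so that its first and second eigenmatrices $P,Q$ are as follows, where $i$ runs over $\{0,\dots,n-1\}$ and $j$ over $\{1,\dots,n-1\}$, and $A_{0,0}$ is the identity relation. Case 1, $k=v$: the adjacency matrices are $A_{0,i},A_1,A_{2,i}$, the primitive idempotents are $E_0,E_1,E_2,E_{3,j},E_{4,j}$, and $$P=\begin{array}{c|ccc} & A_{0,i} & A_1 & A_{2,i} \\ \hline E_0 & 1 & n(v-1) & k \\ E_1 & 1 & n(v-1) & -k \\ E_2 & 1 & -n & 0 \\ E_{3,j} & w^{-ij} & 0 & \sqrt{k}\,w^{-ij} \\ E_{4,j} & w^{-ij} & 0 & -\sqrt{k}\,w^{-ij} \end{array}$$ $$Q=\begin{array}{c|ccccc} & E_0 & E_1 & E_2 & E_{3,j} & E_{4,j} \\ \hline A_{0,i} & 1 & 1 & 2(v-1) & v w^{ij} & v w^{ij} \\ A_1 & 1 & 1 & -2 & 0 & 0 \\ A_{2,i} & 1 & -1 & 0 & \frac{v}{\sqrt{k}}w^{ij} & -\frac{v}{\sqrt{k}}w^{ij} \end{array}$$ Case 2, $k<v$: the adjacency matrices are $A_{0,i},A_1,A_{2,i},A_3$, the primitive idempotents are $E_0,E_1,E_{2,1},E_{2,2},E_{3,j},E_{4,j}$, and $$P=\begin{array}{c|cccc} & A_{0,i} & A_1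 & A_{2,i} & A_3 \\ \hline E_0 & 1 & n(v-1) & k & n(v-k) \\ E_1 & 1 & n(v-1) & -k & -n(v-k) \\ E_{2,1} & 1 & -n & \sqrt{\frac{k(v-k)}{v-1}} & -n\sqrt{\frac{k(v-k)}{v-1}} \\ E_{2,2} & 1 & -n & -\sqrt{\frac{k(v-k)}{v-1}} & n\sqrt{\frac{k(v-k)}{v-1}} \\ E_{3,j} & w^{-ij} & 0 & \sqrt{k}\,w^{-ij} & 0 \\ E_{4,j} & w^{-ij} & 0 & -\sqrt{k}\,w^{-ij} & 0 \end{array}$$ $$Q=\begin{array}{c|cccccc} & E_0 & E_1 & E_{2,1} & E_{2,2} & E_{3,j} & E_{4,j} \\ \hline A_{0,i} & 1 & 1 & v-1 & v-1 & v w^{ij} & v w^{ij} \\ A_1 & 1 & 1 & -1 & -1 & 0 & 0 \\ A_{2,i} & 1 & -1 & \sqrt{\frac{(v-1)(v-k)}{k}} & -\sqrt{\frac{(v-1)(v-k)}{k}} & \frac{v}{\sqrt{k}}w^{ij} & -\frac{v}{\sqrt{k}}w^{ij} \\ A_3 & 1 & -1 & -\sqrt{\frac{(v-1)k}{v-k}} & \sqrt{\frac{(v-1)k}{v-k}} & 0 & 0 \end{array}$$ Then, in either case, there exists a balanced generalized weighing matrix $BGW(v,k,\lambda)$ over $\mathbb{Z}_n$.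
   Context: Balanced generalized weighing matrices. Let $\mathbb{Z}_n$ be the additive cyclic group of order $n$. A $BGW(v,k,\lambda)$ over $\mathbb{Z}_n$ is a $v\times v$ matrix $W=(w_{ij})$ with entries in $\mathbb{Z}_n\cup\{0\}$, where $0$ is a formal zero symbol different from the identity element $\bar 0$ of $\mathbb{Z}_n$, such that each row has exactly $k$ nonzero entries (entries in $\mathbb{Z}_n$) and, for any distinct rows $i,j$, the multiset $\{w_{i\ell}-w_{j\ell}\mid w_{i\ell},w_{j\ell}\in\mathbb{Z}_n\}$ contains every element of $\mathbb{Z}_n$ exactly $\lambda/n$ times. Association schemes. A commutative association scheme with $d$ classes on a finite set $X$ is a collection of nonzero $(0,1)$-matrices $A_0,A_1,\dots,A_d$ (the adjacency matrices) indexed by $X$ such that: $A_0=I_{|X|}$; $\sum_{i=0}^d A_i=J_{|X|}$ (the all-ones matrix); $A_i^t\in\{A_1,\dots,A_d\}$ for every $i\in\{1,\dots,d\}$; every product $A_iA_j$ is a linear combination of $A_0,\dots,A_d$; and $A_iA_j=A_jA_i$ for all $i,j$. The complex span of the $A_i$ is a commutative algebra (the Bose-Mesner algebra), which has a unique basis of primitive idempotents $E_0=\frac{1}{|X|}J_{|X|},E_1,\dots,E_d$. The first eigenmatrix $P=(p_{ij})$ and the second eigenmatrix $Q=(q_{ij})$ are defined by $A_j=\sum_{i} p_{ij}E_i$ and $E_j=\frac{1}{|X|}\sum_{i} q_{ij}A_i$; thus rows of $P$ are indexed by idempotents and columns by adjacency matrices, and vice versa for $Q$. *)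

(* Defs.v *)
From HB Require Import structures.
From mathcomp Require Import all_boot all_order all_algebra.
From mathcomp Require Import complex.
From mathcomp Require Import reals trigo.

Set Implicit Arguments.
Unset Strict Implicit.
Unset Printing Implicit Defensive.

Import Order.TTheory GRing.Theory Num.Theory.
Local Open Scope ring_scope.

(** ** Balanced generalized weighing matrices *)

Section BGW.
Variable G : finZmodType.

(* [None] is the formal zero symbol; [Some 0] is the identity element of G. *)
Definition odiff (x y : option G) : option G :=
  if (x, y) is (Some a, Some b) then Some (a - b) else None.

(* The parameter lambda is a priori only a rational number. *)
Definition is_BGW (v k : nat) (lambda : rat) (W : 'M[option G]_v) : Prop :=
  (forall i, #|[set l | W i l != None]| = k) /\
  (forall i j, i != j -> forall g : G,
     #|[set l | odiff (W i l) (W j l) == Some g]|%:R = lambda / #|G|%:R).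

End BGW.

(* The cyclic group of order n > 0. The library's 'Z_n has order 2 for n = 1. *)
Notation cyclicZ n := ('I_n.-1.+1).

(** ** Commutative association schemes *)

Section Schemes.
Variables (C : fieldType) (X : finType).

Definition bose_mesner (I : finType) (A : I -> 'M[C]_#|X|) :
    {vspace 'M[C]_#|X|} := <<codom A>>%VS.

(* The matrices are indexed by X through its enumeration. The classes are
   labelled by a finite type I, with i0 the label of the identity relation. *)
Record comm_assoc_scheme (I : finType) (i0 : I) (A : I -> 'M[C]_#|X|) : Prop :=
  CommAssocScheme {
    scheme_neq0 : forall i, A i != 0;
    scheme_01 : forall i x y, A i x y = 0 \/ A i x y = 1;
    scheme_id : A i0 = 1%:M;
    scheme_sum : \sum_i A i = const_mx 1;
    scheme_tr : forall i, i != i0 -> exists2 j, j != i0 & (A i)^T = A j;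
    scheme_mul : forall i j, A i *m A j \in bose_mesner A;
    scheme_comm : forall i j, A i *m A j = A j *m A i }.

Definition primitive_idempotent (B : {vspace 'M[C]_#|X|})
    (M : 'M[C]_#|X|) : Prop :=
  [/\ M \in B, M != 0, M *m M = M &
      forall F G, F \in B -> G \in B -> F *m F = F -> G *m G = G ->
        F *m G = 0 -> G *m F = 0 -> M = F + G -> F = 0 \/ G = 0].

Definition primitive_idempotent_basis (I : finType) (A : I -> 'M[C]_#|X|)
    (J : finType) (j0 : J) (E : J -> 'M[C]_#|X|) : Prop :=
  [/\ basis_of (bose_mesner A) (codom E),
      forall j, primitive_idempotent (bose_mesner A) (E j) &
      E j0 = #|X|%:R^-1 *: const_mx 1].

Definition first_eigenmatrix (I J : finType) (A : I -> 'M[C]_#|X|)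
    (E : J -> 'M[C]_#|X|) (P : J -> I -> C) : Prop :=
  forall j, A j = \sum_i P i j *: E i.

Definition second_eigenmatrix (I J : finType) (A : I -> 'M[C]_#|X|)
    (E : J -> 'M[C]_#|X|) (Q : I -> J -> C) : Prop :=
  forall j, E j = #|X|%:R^-1 *: \sum_i Q i j *: A i.

End Schemes.

Definition has_scheme_with_eigenmatrices (C : fieldType) (I J : finType)
    (i0 : I) (j0 : J) (P : J -> I -> C) (Q : I -> J -> C) : Prop :=
  exists (X : finType) (A : I -> 'M[C]_#|X|) (E : J -> 'M[C]_#|X|),
    [/\ comm_assoc_scheme i0 A, primitive_idempotent_basis A j0 E,
        first_eigenmatrix A E P & second_eigenmatrix A E Q].

(** ** Labels of the adjacency matrices and of the primitive idempotents *)

(* In the idempotent labels, t : 'I_n.-1 stands for the index j = t.+1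
   of {1, ..., n-1}. *)

Inductive adj1 (n : nat) := A1_0 of 'I_n | A1_1 | A1_2 of 'I_n.
Arguments A1_1 {n}.

Inductive idem1 (n : nat) :=
  E1_0 | E1_1 | E1_2 | E1_3 of 'I_n.-1 | E1_4 of 'I_n.-1.
Arguments E1_0 {n}. Arguments E1_1 {n}. Arguments E1_2 {n}.

Inductive adj2 (n : nat) := A2_0 of 'I_n | A2_1 | A2_2 of 'I_n | A2_3.
Arguments A2_1 {n}. Arguments A2_3 {n}.

Inductive idem2 (n : nat) :=
  E2_0 | E2_1 | E2_21 | E2_22 | E2_3 of 'I_n.-1 | E2_4 of 'I_n.-1.
Arguments E2_0 {n}. Arguments E2_1 {n}.
Arguments E2_21 {n}. Arguments E2_22 {n}.

Section FinLabels.
Variable n : nat.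

Definition adj1_code (a : adj1 n) : 'I_n + unit + 'I_n :=
  match a with
  | A1_0 i => inl (inl i) | A1_1 => inl (inr tt) | A1_2 i => inr i
  end.
Definition adj1_decode (s : 'I_n + unit + 'I_n) : adj1 n :=
  match s with
  | inl (inl i) => A1_0 i | inl (inr _) => A1_1 | inr i => A1_2 i
  end.
Lemma adj1_codeK : cancel adj1_code adj1_decode.
Proof. by case. Qed.
HB.instance Definition _ := Finite.copy (adj1 n) (can_type adj1_codeK).

Definition idem1_code (e : idem1 n) : 'I_3 + 'I_n.-1 + 'I_n.-1 :=
  match e with
  | E1_0 => inl (inl (inord 0)) | E1_1 => inl (inl (inord 1))
  | E1_2 => inl (inl (inord 2)) | E1_3 j => inl (inr j) | E1_4 j => inr j
  end.
Definition idem1_decode (s : 'I_3 + 'I_n.-1 + 'I_n.-1) : idem1 n :=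
  match s with
  | inl (inl c) => nth E1_0 [:: E1_0; E1_1; E1_2] c
  | inl (inr j) => E1_3 j | inr j => E1_4 j
  end.
Lemma idem1_codeK : cancel idem1_code idem1_decode.
Proof. by case=> //=; rewrite inordK. Qed.
HB.instance Definition _ := Finite.copy (idem1 n) (can_type idem1_codeK).

Definition adj2_code (a : adj2 n) : 'I_n + bool + 'I_n :=
  match a with
  | A2_0 i => inl (inl i) | A2_1 => inl (inr true)
  | A2_2 i => inr i | A2_3 => inl (inr false)
  end.
Definition adj2_decode (s : 'I_n + bool + 'I_n) : adj2 n :=
  match s with
  | inl (inl i) => A2_0 i | inl (inr true) => A2_1
  | inl (inr false) => A2_3 | inr i => A2_2 i
  end.
Lemma adj2_codeK : cancel adj2_code adj2_decode.
Proof. by case. Qed.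
HB.instance Definition _ := Finite.copy (adj2 n) (can_type adj2_codeK).

Definition idem2_code (e : idem2 n) : 'I_4 + 'I_n.-1 + 'I_n.-1 :=
  match e with
  | E2_0 => inl (inl (inord 0)) | E2_1 => inl (inl (inord 1))
  | E2_21 => inl (inl (inord 2)) | E2_22 => inl (inl (inord 3))
  | E2_3 j => inl (inr j) | E2_4 j => inr j
  end.
Definition idem2_decode (s : 'I_4 + 'I_n.-1 + 'I_n.-1) : idem2 n :=
  match s with
  | inl (inl c) => nth E2_0 [:: E2_0; E2_1; E2_21; E2_22] c
  | inl (inr j) => E2_3 j | inr j => E2_4 j
  end.
Lemma idem2_codeK : cancel idem2_code idem2_decode.
Proof. by case=> //=; rewrite inordK. Qed.
HB.instance Definition _ := Finite.copy (idem2 n) (can_type idem2_codeK).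

End FinLabels.

(** ** The eigenmatrices *)

Section Eigenmatrices.
Variables (R : realType) (n v k : nat).
Local Notation C := R[i].

Definition root_unity : C :=
  Complex (cos (2 * pi / n%:R)) (sin (2 * pi / n%:R)).

Local Notation w := root_unity.
Local Notation rsqrt x := ((Num.sqrt (x : R))%:C%C).
Local Notation vR := (v%:R : R).
Local Notation kR := (k%:R : R).

Definition P1 (e : idem1 n) (a : adj1 n) : C :=
  match e, a with
  | E1_0, A1_0 _ => 1
  | E1_0, A1_1 => n%:R * (v%:R - 1)
  | E1_0, A1_2 _ => k%:R
  | E1_1, A1_0 _ => 1
  | E1_1, A1_1 => n%:R * (v%:R - 1)
  | E1_1, A1_2 _ => - k%:R
  | E1_2, A1_0 _ => 1
  | E1_2, A1_1 => - n%:R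
  | E1_2, A1_2 _ => 0
  | E1_3 j, A1_0 i => w ^- (i * j.+1)
  | E1_3 _, A1_1 => 0
  | E1_3 j, A1_2 i => rsqrt kR * w ^- (i * j.+1)
  | E1_4 j, A1_0 i => w ^- (i * j.+1)
  | E1_4 _, A1_1 => 0
  | E1_4 j, A1_2 i => - rsqrt kR * w ^- (i * j.+1)
  end.

Definition Q1 (a : adj1 n) (e : idem1 n) : C :=
  match a, e with
  | A1_0 _, E1_0 => 1
  | A1_0 _, E1_1 => 1
  | A1_0 _, E1_2 => 2 * (v%:R - 1)
  | A1_0 i, E1_3 j => v%:R * w ^+ (i * j.+1)
  | A1_0 i, E1_4 j => v%:R * w ^+ (i * j.+1)
  | A1_1, E1_0 => 1
  | A1_1, E1_1 => 1
  | A1_1, E1_2 => - 2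
  | A1_1, E1_3 _ => 0
  | A1_1, E1_4 _ => 0
  | A1_2 _, E1_0 => 1
  | A1_2 _, E1_1 => - 1
  | A1_2 _, E1_2 => 0
  | A1_2 i, E1_3 j => v%:R / rsqrt kR * w ^+ (i * j.+1)
  | A1_2 i, E1_4 j => - (v%:R / rsqrt kR) * w ^+ (i * j.+1)
  end.

Definition P2 (e : idem2 n) (a : adj2 n) : C :=
  match e, a with
  | E2_0, A2_0 _ => 1
  | E2_0, A2_1 => n%:R * (v%:R - 1)
  | E2_0, A2_2 _ => k%:R
  | E2_0, A2_3 => n%:R * (v%:R - k%:R)
  | E2_1, A2_0 _ => 1
  | E2_1, A2_1 => n%:R * (v%:R - 1)
  | E2_1, A2_2 _ => - k%:R
  | E2_1, A2_3 => - (n%:R * (v%:R - k%:R))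
  | E2_21, A2_0 _ => 1
  | E2_21, A2_1 => - n%:R
  | E2_21, A2_2 _ => rsqrt (kR * (vR - kR) / (vR - 1))
  | E2_21, A2_3 => - n%:R * rsqrt (kR * (vR - kR) / (vR - 1))
  | E2_22, A2_0 _ => 1
  | E2_22, A2_1 => - n%:R
  | E2_22, A2_2 _ => - rsqrt (kR * (vR - kR) / (vR - 1))
  | E2_22, A2_3 => n%:R * rsqrt (kR * (vR - kR) / (vR - 1))
  | E2_3 j, A2_0 i => w ^- (i * j.+1)
  | E2_3 _, A2_1 => 0
  | E2_3 j, A2_2 i => rsqrt kR * w ^- (i * j.+1)
  | E2_3 _, A2_3 => 0
  | E2_4 j, A2_0 i => w ^- (i * j.+1)
  | E2_4 _, A2_1 => 0
  | E2_4 j, A2_2 i => - rsqrt kR * w ^- (i * j.+1)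
  | E2_4 _, A2_3 => 0
  end.

Definition Q2 (a : adj2 n) (e : idem2 n) : C :=
  match a, e with
  | A2_0 _, E2_0 => 1
  | A2_0 _, E2_1 => 1
  | A2_0 _, E2_21 => v%:R - 1
  | A2_0 _, E2_22 => v%:R - 1
  | A2_0 i, E2_3 j => v%:R * w ^+ (i * j.+1)
  | A2_0 i, E2_4 j => v%:R * w ^+ (i * j.+1)
  | A2_1, E2_0 => 1
  | A2_1, E2_1 => 1
  | A2_1, E2_21 => - 1
  | A2_1, E2_22 => - 1
  | A2_1, E2_3 _ => 0
  | A2_1, E2_4 _ => 0
  | A2_2 _, E2_0 => 1
  | A2_2 _, E2_1 => - 1
  | A2_2 _, E2_21 => rsqrt ((vR - 1) * (vR - kR) / kR)
  | A2_2 _, E2_22 => - rsqrt ((vR - 1) * (vR - kR) / kR)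
  | A2_2 i, E2_3 j => v%:R / rsqrt kR * w ^+ (i * j.+1)
  | A2_2 i, E2_4 j => - (v%:R / rsqrt kR) * w ^+ (i * j.+1)
  | A2_3, E2_0 => 1
  | A2_3, E2_1 => - 1
  | A2_3, E2_21 => - rsqrt ((vR - 1) * kR / (vR - kR))
  | A2_3, E2_22 => rsqrt ((vR - 1) * kR / (vR - kR))
  | A2_3, E2_3 _ => 0
  | A2_3, E2_4 _ => 0
  end.

End Eigenmatrices.

(* Main.v *)
Require Import Defs.
From HB Require Import structures.
From mathcomp Require Import all_boot all_order all_algebra.
From mathcomp Require Import complex.
From mathcomp Require Import reals trigo.
From mathcomp Require Import ring zify.

Set Implicit Arguments.
Unset Strict Implicit.
Unset Printing Implicit Defensive.

Import Order.TTheory GRing.Theory Num.Theory.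
Local Open Scope ring_scope.

(**
 Orthogonality of the primitive idempotents turns every product of adjacency matrices into a
 computation with the rows of [P]. It shows that the [A_{0,g}] are permutation matrices forming
 a free action of [Z_n], that [A_{2,g} A_{0,h} = A_{2,g+h}], and that
 [A_{2,g} A_{2,0} = k A_{0,g} + (lambda / n) A_1]. For [g = 0] the diagonal of the last identity
 equals the valency [k], which forces [A_{2,0}] to be symmetric.
 The matrix [T = A_1 + sum_g A_{0,g}] is a multiple of [E_0 + E_1] (read off from [Q]), hence
 an equivalence relation with two classes of [v n] points, each a union of [v] orbits. Taking
 representatives [x_a], [y_b] of the orbits in the two classes, the weighing matrix has
 entry [g] at [(a, b)] when [(x_a, y_b)] lies in [A_{2,g}] and the formal zero otherwise:
 differences of two rows are counted by the entries of [A_{2,g} A_{2,0}] at pairs in [A_1].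
*)

(** * Bose-Mesner algebras *)

Section BoseMesner.
Variables (C : fieldType) (X I J : finType) (i0 : I) (j0 : J).
Variables (A : I -> 'M[C]_#|X|) (E : J -> 'M[C]_#|X|).
Variables (P : J -> I -> C) (Q : I -> J -> C).
Hypotheses (schA : comm_assoc_scheme i0 A).
Hypotheses (idE : primitive_idempotent_basis A j0 E).
Hypotheses (eigP : first_eigenmatrix A E P) (eigQ : second_eigenmatrix A E Q).
Local Notation B := (bose_mesner A).

Lemma mem_bose_mesner F :
  F \in B -> exists c : I -> C, F = \sum_i c i *: A i.
Proof.
move/(@coord_span _ _ _ (codom_tuple A)) => ->.
exists (fun i => coord (codom_tuple A) (enum_rank i) F).
rewrite [RHS](reindex (@enum_val I predT)) /=; last first.
  by apply: onW_bij; apply: enum_val_bij.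
apply: eq_bigr => i _; rewrite enum_valK; congr (_ *: _).
by rewrite (nth_codom _ _ i).
Qed.

Lemma mul_bose_mesner F G : F \in B -> G \in B -> F *m G \in B.
Proof.
move=> /mem_bose_mesner[c ->] /mem_bose_mesner[d ->].
rewrite mulmx_suml; apply: memv_suml => i _.
rewrite mulmx_sumr; apply: memv_suml => j _.
by rewrite -scalemxAl -scalemxAr !memvZ ?(scheme_mul schA).
Qed.

Lemma comm_bose_mesner F G : F \in B -> G \in B -> F *m G = G *m F.
Proof.
move=> /mem_bose_mesner[c ->] /mem_bose_mesner[d ->].
rewrite mulmx_suml mulmx_sumr; apply: eq_bigr => i _.
rewrite mulmx_suml mulmx_sumr; apply: eq_bigr => j _.
by rewrite -!scalemxAl -!scalemxAr (scheme_comm schA) scalerA mulrC -scalerA.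
Qed.

(** [F] splits into the orthogonal idempotents [F *m G] and [F - F *m G] of the algebra, and
    primitivity makes one of them vanish. *)
Lemma primitive_idempotent_absorb F G :
  primitive_idempotent B F -> primitive_idempotent B G ->
  F *m G = 0 \/ F *m G = F.
Proof.
move=> [FB _ FF primF] [GB _ GG _].
have cFG := comm_bose_mesner FB GB.
have eFGF : F *m (F *m G) = F *m G by rewrite mulmxA FF.
have eFGF' : F *m G *m F = F *m G by rewrite -mulmxA -cFG.
have eFGFG : F *m G *m (F *m G) = F *m G by rewrite mulmxA eFGF' -mulmxA GG.
case: (primF (F *m G) (F - F *m G)).
- exact: mul_bose_mesner.
- by rewrite memvB ?mul_bose_mesner.
- exact: eFGFG.
- by rewrite mulmxBl !mulmxBr FF eFGF eFGF' eFGFG subrr subr0.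
- by rewrite mulmxBr eFGF' eFGFG subrr.
- by rewrite mulmxBl eFGF eFGFG subrr.
- by rewrite addrC subrK.
- by left.
by move/eqP; rewrite subr_eq0 => /eqP <-; right.
Qed.

(** If [E i *m E j] is nonzero, absorption in both orders and commutativity identify it with both
    [E i] and [E j], impossible for distinct members of a basis. *)
Lemma idempotents_orthogonal i j : E i *m E j = if i == j then E i else 0.
Proof.
have [bE primE _] := idE.
case: eqVneq => [<- | neq_ij]; first by case: (primE i).
have [// | eEi] := primitive_idempotent_absorb (primE i) (primE j).
have [Ei Ej] : E i \in B /\ E j \in B by case: (primE i); case: (primE j).
have [// | eEj] := primitive_idempotent_absorb (primE j) (primE i).
  by move=> e0; rewrite comm_bose_mesner.
have /injectiveP injE := free_uniq (basis_free bE).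
by case/eqP: neq_ij; apply: injE; rewrite -eEi comm_bose_mesner.
Qed.

Lemma adj_mul_idem i j : A i *m E j = P j i *: E j.
Proof.
rewrite eigP mulmx_suml (bigD1 j) //= big1 ?addr0 => [|l neq_lj].
  by rewrite -scalemxAl idempotents_orthogonal eqxx.
by rewrite -scalemxAl idempotents_orthogonal (negPf neq_lj) scaler0.
Qed.

Lemma adj_mul i j : A i *m A j = \sum_e (P e i * P e j) *: E e.
Proof.
rewrite [in LHS](eigP j) mulmx_sumr; apply: eq_bigr => e _.
by rewrite -scalemxAr adj_mul_idem scalerA mulrC.
Qed.

(** Since [P e i] is the eigenvalue of [A i] on the image of [E e], a product formula need only be
    checked row by row in [P]. *)
Lemma adj_mul_eq i j l :
  (forall e, P e i * P e j = P e l) -> A i *m A j = A l.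
Proof.
by move=> eP; rewrite adj_mul [RHS]eigP; apply: eq_bigr => e _; rewrite eP.
Qed.

Lemma adj_mul_eq2 i j l m (a b : C) :
  (forall e, P e i * P e j = a * P e l + b * P e m) ->
  A i *m A j = a *: A l + b *: A m.
Proof.
move=> eP; rewrite adj_mul (eigP l) (eigP m) !scaler_sumr -big_split.
by apply: eq_bigr => e _; rewrite eP scalerDl !scalerA.
Qed.

(** Otherwise the inverse would be 0 by convention and [E j0] would vanish, unlike a primitive
    idempotent. *)
Lemma card_points_neq0 : #|X|%:R != 0 :> C.
Proof.
have [_ primE eE0] := idE; have [_ + _ _] := primE j0.
by rewrite eE0; apply: contra_neq => ->; rewrite invr0 scale0r.
Qed.

Lemma const_idem0 : #|X|%:R *: E j0 = const_mx 1.
Proof. by have [_ _ ->] := idE; rewrite scalerA divff ?scale1r ?card_points_neq0. Qed.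

Lemma adj_mul_const i : A i *m const_mx 1 = P j0 i *: const_mx 1 :> 'M_#|X|.
Proof.
by rewrite -const_idem0 -scalemxAr adj_mul_idem !scalerA mulrC.
Qed.

(** Row [j0] of [P] lists the valencies: apply the sum of all adjacency matrices to the all-ones
    matrix. *)
Lemma card_points_first_row : \sum_i P j0 i = #|X|%:R.
Proof.
have : (\sum_i A i) *m const_mx 1 = (\sum_i P j0 i) *: const_mx 1 :> 'M_#|X|.
  rewrite mulmx_suml scaler_suml; apply: eq_bigr => i _; exact: adj_mul_const.
rewrite (scheme_sum schA) => /matrixP eJ.
have x : 'I_#|X|.
  by have := card_points_neq0; case: #|X| => [|N _]; rewrite ?eqxx //; exact: ord0.
have := eJ x x; rewrite !mxE mulr1 => <-.
under eq_bigr do rewrite !mxE mulr1.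
by rewrite sumr_const card_ord.
Qed.

Lemma idem_pair_eq i j (T : 'M[C]_#|X|) (a : C) :
  a != 0 -> \sum_l (Q l i + Q l j) *: A l = a *: T ->
  T = (#|X|%:R / a) *: (E i + E j).
Proof.
move=> a0 eT; rewrite (eigQ i) (eigQ j) -scalerDr -big_split scalerA /=.
under eq_bigr do rewrite -scalerDl.
by rewrite eT scalerA mulrAC divfK // divff ?scale1r ?card_points_neq0.
Qed.

(* A relation whose matrix is a multiple of a sum of two idempotents has a square that is a
   multiple of it, so it is transitive. *)
Lemma idem_pair_square i j (T : 'M[C]_#|X|) (a : C) :
  i != j -> a != 0 -> \sum_l (Q l i + Q l j) *: A l = a *: T ->
  T *m T = (#|X|%:R / a) *: T.
Proof.
move=> neq_ij a0 /(idem_pair_eq a0) ->.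
rewrite -scalemxAr -scalemxAl; do 2!congr (_ *: _).
rewrite mulmxDl !mulmxDr !idempotents_orthogonal !eqxx (eq_sym j) (negPf neq_ij).
by rewrite addr0 add0r.
Qed.

(** The all-ones matrix is a multiple of [E j0], so [E j0 + E j] fixes it; this yields the valency
    of [T]. *)
Lemma idem_pair_const j (T : 'M[C]_#|X|) (a : C) :
  j0 != j -> a != 0 -> \sum_l (Q l j0 + Q l j) *: A l = a *: T ->
  T *m const_mx 1 = (#|X|%:R / a) *: const_mx 1 :> 'M_#|X|.
Proof.
move=> neq_j a0 /(idem_pair_eq a0) ->.
rewrite -const_idem0 -!scalemxAl -!scalemxAr; do 2!congr (_ *: _).
by rewrite mulmxDl !idempotents_orthogonal eqxx eq_sym (negPf neq_j) addr0.
Qed.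

End BoseMesner.

(** * Weighing matrices from free actions *)

Section FreeAction.
Variables (G : finZmodType) (Y : finType) (act : G -> Y -> Y).
Hypothesis act0 : forall x, act 0 x = x.
Hypothesis actD : forall g h x, act h (act g x) = act (g + h) x.
Hypothesis act_free : forall g x, act g x = x -> g = 0.

Definition same_orbit : rel Y := fun x y => [exists g, act g x == y].

Lemma act_inj x : injective (act^~ x).
Proof.
move=> g h /= eq_gh; apply/eqP; rewrite -subr_eq0; apply/eqP.
by apply: (act_free (x := x)); rewrite -actD eq_gh actD subrr act0.
Qed.

Lemma same_orbit_equiv : equivalence_rel same_orbit.
Proof.
move=> x y z; split; first by apply/existsP; exists 0; rewrite act0.
case/existsP=> g /eqP <-{y}; apply/existsP/existsP => -[h /eqP <-].
  by exists (h - g); rewrite actD addrC subrK.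
by exists (g + h); rewrite actD.
Qed.

(** By freeness the orbits cut [S] into blocks of size [#|G|], so there are [v] of them; [r]
    enumerates a transversal. *)
Lemma orbit_representatives (S : {set Y}) (v : nat) :
    (forall g x, x \in S -> act g x \in S) -> #|S| = (v * #|G|)%N ->
  exists r : 'I_v -> Y, [/\ forall b, r b \in S,
    forall b b', same_orbit (r b) (r b') -> b = b' &
    forall y, y \in S -> exists b, same_orbit (r b) y].
Proof.
move=> Sact cardS; set OS := equivalence_partition same_orbit S.
have eqR : {in S & &, equivalence_rel same_orbit}.
  by move=> x y z _ _ _; apply: same_orbit_equiv.
have partOS : partition OS S by apply: equivalence_partitionP.
have cardO : {in OS, forall O : {set Y}, #|O| = #|G|}.
  move=> O /imsetP[x xS ->]; rewrite -(card_imset predT (@act_inj x)).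
  apply: eq_card => y; rewrite !inE; apply/andP/imsetP.
    by case=> _ /existsP[g /eqP <-]; exists g.
  by case=> g _ ->; split; [exact: Sact | apply/existsP; exists g].
have cardOS : #|OS| = v.
  apply/eqP; rewrite -(eqn_pmul2r (m := #|G|)); last by apply/card_gt0P; exists 0.
  by rewrite -cardS (card_uniform_partition cardO partOS).
have trT := transversalP partOS; set T := transversal OS S in trT *.
have cardT : #|T| = v by rewrite (card_transversal trT).
exists (fun b => enum_val (cast_ord (esym cardT) b)); split=> [b|b b'|y yS].
- exact: subsetP (transversal_sub trT) _ (enum_valP _).
- set x := enum_val _; set x' := enum_val _ => oxx'.
  have [xT x'T] : x \in T /\ x' \in T by split; apply: enum_valP.
  have [xS x'S] : x \in S /\ x' \in S.
    by split; apply: subsetP (transversal_sub trT) _ _.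
  have /enum_val_inj/cast_ord_inj // : x = x'.
  apply: (pblock_inj trT) => //.
  apply/eqP; rewrite eq_pblock ?(partition_trivIset partOS) ?(cover_partition partOS) //.
  by rewrite (pblock_equivalence_partition eqR).
have yc : y \in cover OS by rewrite (cover_partition partOS).
pose x := transversal_repr y T (pblock OS y).
have xT : x \in T by apply: (repr_mem_transversal trT); apply: pblock_mem.
have xy : x \in pblock OS y by apply: (repr_mem_pblock trT); apply: pblock_mem.
exists (cast_ord cardT (enum_rank_in xT x)).
rewrite cast_ordK enum_rankK_in //.
have xS : x \in S by apply: subsetP (transversal_sub trT) _ _.
move: xy; rewrite (pblock_equivalence_partition eqR) // => oyx.
have [_ Ryx] := same_orbit_equiv y x y; rewrite -(Ryx oyx).
by case: (same_orbit_equiv y y y).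
Qed.

Variables (c : Y -> Y -> option G).
Hypothesis c_act : forall x y g, c x (act g y) = omap (+%R^~ g) (c x y).

(* Each orbit on which [c x] is not [None] contains exactly one point where it is [Some 0]. *)
Lemma card_orbits_color (v : nat) (S : {set Y}) (s : 'I_v -> Y) (p : pred Y) x :
    (forall b b', same_orbit (s b) (s b') -> b = b') ->
    (forall y, y \in S -> exists b, same_orbit (s b) y) ->
    (forall y, c x y != None -> y \in S) ->
    (forall g y, p (act g y) = p y) ->
  #|[set b | (c x (s b) != None) && p (s b)]| =
  #|[set y | (c x y == Some 0) && p y]|.
Proof.
move=> s_inj s_surj cS p_act.
(* Equivariance makes [f b] the point of the orbit of [s b] with colour [Some 0]; if [s b] has
   colour [None], the default leaves it in place. *)
pose f b := act (- odflt 0 (c x (s b))) (s b).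
have f_inj : injective f.
  move=> b b' eqf; apply: s_inj; apply/existsP.
  exists (- odflt 0 (c x (s b)) + odflt 0 (c x (s b'))).
  by rewrite -actD -/(f b) eqf actD addNr act0.
rewrite -(card_imset _ f_inj); apply: eq_card => y; rewrite inE.
apply/imsetP/andP=> [[b] | [/eqP cxy py]].
  rewrite inE => /andP[cb pb] ->; rewrite /f p_act c_act.
  by case: (c x (s b)) cb => //= g _; rewrite subrr.
have [|b /existsP[g /eqP eq_y]] := s_surj y; first by apply: cS; rewrite cxy.
have csb : c x (s b) = Some (- g).
  by rewrite -[s b]act0 -(subrr g) -actD eq_y c_act cxy /= add0r.
exists b; last by rewrite /f csb /= opprK eq_y.
by rewrite inE csb -(p_act g) eq_y.
Qed.

Lemma BGW_of_free_action (v k : nat) (lambda : rat) (S1 S2 : {set Y}) :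
    (forall g x, x \in S1 -> act g x \in S1) -> #|S1| = (v * #|G|)%N ->
    (forall g x, x \in S2 -> act g x \in S2) -> #|S2| = (v * #|G|)%N ->
    (forall x y, x \in S1 -> c x y != None -> y \in S2) ->
    (forall x, #|[set y | c x y == Some 0]| = k) ->
    (forall x x' g, x \in S1 -> x' \in S1 -> ~~ same_orbit x x' ->
      #|[set z | (c x z == Some g) && (c x' z == Some 0)]|%:R = lambda / #|G|%:R) ->
  exists W : 'M[option G]_v, is_BGW k lambda W.
Proof.
move=> S1act cS1 S2act cS2 cS12 rowk pairl.
have [r [rS1 r_inj _]] := orbit_representatives S1act cS1.
have [s [_ s_inj s_surj]] := orbit_representatives S2act cS2.
have cS a y : c (r a) y != None -> y \in S2 by apply: cS12.
exists (\matrix_(a, b) c (r a) (s b)); split=> [a | a a' neq_aa' g].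
  rewrite -(rowk (r a)).
  have := @card_orbits_color v S2 s predT (r a) s_inj s_surj (cS a) (fun _ _ => erefl).
  set N1 := #|_|; set N2 := #|_| => eN.
  by transitivity N1; last rewrite eN; apply: eq_card => y; rewrite !inE ?mxE andbT.
have o_aa' : ~~ same_orbit (r a) (r a').
  by apply: contra neq_aa' => /r_inj ->.
rewrite -(pairl (r a) (r a') g) //; congr _%:R.
(* The difference of two colours is constant on orbits, so it may be counted at points where the
   second colour is 0; there it equals the first colour. *)
pose p y := odiff (c (r a) y) (c (r a') y) == Some g.
have p_act h y : p (act h y) = p y.
  rewrite /p !c_act; case: (c _ _) => [i|] //; case: (c _ _) => [j|] //=.
  by rewrite /odiff opprD addrACA subrr addr0.
have := @card_orbits_color v S2 s p (r a') s_inj s_surj (cS a') p_act.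
set N1 := #|_|; set N2 := #|_| => eN.
transitivity N1; last rewrite eN; apply: eq_card => y; rewrite !inE ?mxE /p.
  by case: (c (r a) _) => [i|]; case: (c (r a') _).
case: (c (r a') y) => [j|]; last by rewrite andbF.
case: (c (r a) y) => [i|]; last by rewrite andbF.
by rewrite andbC /odiff (inj_eq Some_inj j); case: (eqVneq j 0) => [->|]; rewrite ?subr0 ?andbF.
Qed.

End FreeAction.

(** * Matrices of relations *)

Section RelationMatrices.
Variables (F : numFieldType) (N : nat).
Implicit Types r s t : rel 'I_N.

Definition relmx r : 'M[F]_N := \matrix_(x, y) (r x y)%:R.

Lemma relmx_mulE r s x y :
  (relmx r *m relmx s) x y = #|[set z | r x z && s z y]|%:R.
Proof.
rewrite mxE -sum1_card natr_sum [RHS]big_mkcond; apply: eq_bigr => z _.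
by rewrite !mxE inE; case: (r x z); case: (s z y); rewrite ?(mulr0, mul0r, mulr1).
Qed.

Lemma relmx_mul_const r d : relmx r *m const_mx 1 = d%:R *: const_mx 1 :> 'M_N ->
  forall x, #|[set z | r x z]| = d.
Proof.
move=> /matrixP rJ x; apply/eqP; rewrite -(eqr_nat F); apply/eqP.
have := rJ x x; rewrite !mxE mulr1 => <-.
rewrite -sum1_card natr_sum big_mkcond; apply: eq_bigr => z _.
by rewrite !mxE inE mulr1; case: (r x z).
Qed.

(** The intermediate point [y] makes the entry of the product a positive count, hence nonzero in
    characteristic 0. *)
Lemma relmx_mul_sub r s t a x y z :
  relmx r *m relmx s = a *: relmx t -> r x y -> s y z -> t x z.
Proof.
move=> /matrixP/(_ x z); rewrite relmx_mulE !mxE => + rxy syz.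
case: (t x z) => //; rewrite mulr0 => /eqP; rewrite pnatr_eq0 cards_eq0.
by move/eqP/setP/(_ y); rewrite !inE rxy syz.
Qed.

(* The [x]-th diagonal entry of the square counts the out-neighbours of [x] that are also
   in-neighbours; if this is the whole valency, then every arc is reversed. *)
Lemma relmx_sym r d : (forall x, #|[set z | r x z]| = d) ->
  (forall x, (relmx r *m relmx r) x x = d%:R) -> symmetric r.
Proof.
move=> val_r diag_r; apply: symmetric_from_pre => x y rxy.
have sub_r : [set z | r x z && r z x] \subset [set z | r x z].
  by apply/subsetP => z; rewrite !inE => /andP[].
have : [set z | r x z && r z x] == [set z | r x z].
  rewrite eqEcard sub_r val_r; have := diag_r x; rewrite relmx_mulE.
  by move/eqP; rewrite eqr_nat => /eqP ->; rewrite leqnn.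
by move/eqP/setP/(_ y); rewrite !inE rxy.
Qed.

End RelationMatrices.

(** * Weighing matrices from coloured relations *)

(** The labels whose relations together form the equivalence relation with two classes. *)
Definition half_class n (a : adj2 n) : bool :=
  if a is (A2_0 _ | A2_1) then true else false.

Section Coloring.
Variables (F : numFieldType) (N m v k : nat) (lambda : rat).
Local Notation n := m.+1.
(** Both cases use the labels of the case [k < v]; when [k = v], the colour [A2_3] does not
    occur. *)
Variable col : 'I_N -> 'I_N -> adj2 n.

Definition color_rel (a : adj2 n) : rel 'I_N := fun x y => col x y == a.
Definition half_rel : rel 'I_N := fun x y => half_class (col x y).

Local Notation M a := (relmx F (color_rel a)).
Local Notation T := (relmx F half_rel).

Hypothesis v_gt0 : (0 < v)%N.
Hypothesis cardN : N = (v * n).*2.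
Hypothesis M_id : M (A2_0 0) = 1%:M.
Hypothesis M_mul00 : forall g h, M (A2_0 g) *m M (A2_0 h) = M (A2_0 (g + h)).
Hypothesis M_mul20 : forall g h, M (A2_2 g) *m M (A2_0 h) = M (A2_2 (g + h)).
Hypothesis M_mul22 : forall g, M (A2_2 g) *m M (A2_2 0) =
  k%:R *: M (A2_0 g) + ratr (lambda / n%:R) *: M A2_1.
Hypothesis M_val0 : forall g, M (A2_0 g) *m const_mx 1 = const_mx 1 :> 'M_N.
Hypothesis M_val2 : forall g,
  M (A2_2 g) *m const_mx 1 = k%:R *: const_mx 1 :> 'M_N.
Hypothesis T_mul : T *m T = (v * n)%:R *: T.
Hypothesis T_val : T *m const_mx 1 = (v * n)%:R *: const_mx 1 :> 'M_N.

Definition shift (g : 'I_n) (x : 'I_N) : 'I_N := odflt x [pick y | col x y == A2_0 g].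

Lemma shiftP g x y : (col x y == A2_0 g) = (y == shift g x).
Proof.
have /cards1P[z /setP eq_z] : #|[set y | color_rel (A2_0 g) x y]| == 1%N.
  by apply/eqP/(@relmx_mul_const F); rewrite mulr1n scale1r.
have col_z y' : (col x y' == A2_0 g) = (y' == z) by have := eq_z y'; rewrite !inE.
rewrite /shift; case: pickP => [z' /= | /(_ z) /=]; rewrite col_z ?eqxx //.
by move/eqP->.
Qed.

Lemma color_mul a b c x y z :
  M a *m M b = M c -> col x y = a -> col y z = b -> col x z = c.
Proof.
move=> Mab /eqP cxy /eqP cyz; apply/eqP.
apply: (@relmx_mul_sub F N (color_rel a) (color_rel b) (color_rel c) 1 x y z) => //.
by rewrite scale1r.
Qed.

Lemma color_mul00 x y z g h :
  col x y = A2_0 g -> col y z = A2_0 h -> col x z = A2_0 (g + h).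
Proof. exact/color_mul/M_mul00. Qed.

Lemma color_mul20 x y z g h :
  col x y = A2_2 g -> col y z = A2_0 h -> col x z = A2_2 (g + h).
Proof. exact/color_mul/M_mul20. Qed.

Lemma color_shift g x : col x (shift g x) = A2_0 g.
Proof. by apply/eqP; rewrite shiftP. Qed.

Lemma color_diag x : col x x = A2_0 0.
Proof.
have /matrixP/(_ x x) := M_id; rewrite !mxE eqxx /color_rel.
by case: (col x x =P _) => // _ /eqP; rewrite eq_sym oner_eq0.
Qed.

Lemma shift0 x : shift 0 x = x.
Proof. by apply/esym/eqP; rewrite -shiftP color_diag. Qed.

Lemma shiftD g h x : shift h (shift g x) = shift (g + h) x.
Proof. by apply/eqP; rewrite -shiftP; apply/eqP/color_mul00; exact: color_shift. Qed.

Lemma shift_free g x : shift g x = x -> g = 0.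
Proof. by move=> eq_x; have := color_shift g x; rewrite eq_x color_diag => -[]. Qed.

Definition entry (x y : 'I_N) : option 'I_n := if col x y is A2_2 g then Some g else None.

Lemma entryP x y g : (entry x y == Some g) = (col x y == A2_2 g).
Proof. by rewrite /entry; apply/eqP/eqP; case: (col x y) => // h [->]. Qed.

Lemma entry_shift x y g : entry x (shift g y) = omap (+%R^~ g) (entry x y).
Proof.
case exy: (entry x y) => [h|] /=.
  move/eqP: exy; rewrite entryP => /eqP exy.
  by apply/eqP; rewrite entryP; apply/eqP/(color_mul20 exy)/color_shift.
(* A colour at the shifted point would be carried back to [y] by shifting with [- g]. *)
case exy': (entry x _) => [h|] //.
move/eqP: exy'; rewrite entryP => /eqP exy'.
have := color_mul20 exy' (color_shift (- g) _); rewrite shiftD subrr shift0.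
by move/eqP; rewrite -entryP exy.
Qed.

Lemma half_refl x : half_rel x x.
Proof. by rewrite /half_rel color_diag. Qed.

Lemma half_trans x y z : half_rel x y -> half_rel y z -> half_rel x z.
Proof. by apply: relmx_mul_sub T_mul. Qed.

(** By reflexivity each diagonal entry of the square of [T] is [v * n], its valency, so every arc is
    reversed. *)
Lemma half_sym : symmetric half_rel.
Proof.
apply: (@relmx_sym F _ _ (v * n)); first exact: relmx_mul_const T_val.
by move=> x; rewrite T_mul !mxE half_refl mulr1.
Qed.

Lemma half_shift g x y : half_rel x (shift g y) = half_rel x y.
Proof.
have half_s h z : half_rel z (shift h z) by rewrite /half_rel color_shift.
by apply/idP/idP => /half_trans; apply; [rewrite half_sym|]; exact: half_s.
Qed.

Lemma color2_sym : symmetric (color_rel (A2_2 0)).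
Proof.
apply: (@relmx_sym F _ _ k); first exact: relmx_mul_const (M_val2 0).
by move=> x; rewrite M_mul22 !mxE /color_rel color_diag eqxx mulr1 mulr0 addr0.
Qed.

Lemma BGW_of_coloring : exists W : 'M[option 'I_n]_v, is_BGW k lambda W.
Proof.
have x0 : 'I_N.
  by have : (0 < N)%N; [rewrite cardN double_gt0 muln_gt0 v_gt0 | move/Ordinal; exact].
(* [S] supplies the rows and its complement, also of size [v * n], the columns. *)
pose S := [set x | half_rel x0 x].
have cardS : #|S| = (v * n)%N by exact: relmx_mul_const T_val x0.
have Sshift g x : (shift g x \in S) = (x \in S) by rewrite !inE half_shift.
apply: (BGW_of_free_action shift0 shiftD shift_free entry_shift (S1 := S) (S2 := ~: S)).
- by move=> g x; rewrite Sshift.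
- by rewrite cardS card_ord.
- by move=> g x; rewrite !in_setC Sshift.
- by rewrite cardsCs setCK cardS !card_ord cardN -addnn addnK.
- move=> x y; rewrite !inE => x0x exy; apply: contraTN exy => x0y.
  have : half_rel x y by apply: half_trans x0y; rewrite half_sym.
  by rewrite /half_rel /entry; case: (col x y).
- move=> x; rewrite -(relmx_mul_const (M_val2 0) x); apply: eq_card => y.
  by rewrite !inE entryP.
move=> x x' g; rewrite !inE => x0x x0x' oxx'.
(* Within one class the colour is [A2_0 h] or [A2_1], and the former would put both points in one
   orbit. *)
have colxx' : col x x' = A2_1.
  have : half_rel x x' by apply: half_trans x0x'; rewrite half_sym.
  rewrite /half_rel; case exx': (col x x') => [h||h|] // _.
  case/negP: oxx'; apply/existsP; exists h.
  by rewrite eq_sym -shiftP exx'.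
have := M_mul22 g => /matrixP/(_ x x'); rewrite relmx_mulE !mxE /color_rel colxx' eqxx.
rewrite mulr0 add0r mulr1 card_ord -(ratr_nat F #|_|) => /(fmorph_inj (@ratr F)) <-; congr _%:R.
(* The product counts [z] with [(z, x')] of colour [A2_2 0]; symmetry of that colour reverses the
   pair. *)
apply: eq_card => z; rewrite !inE !entryP; congr (_ && _).
by have := color2_sym x' z; rewrite /color_rel.
Qed.

End Coloring.

(** * Schemes with the prescribed eigenmatrices *)

(** The 0-1 entries at [(x, y)] sum to 1, so exactly one class contains the pair and the default
    [i0] is never reached. *)
Lemma scheme_coloring (C : numFieldType) (X I : finType) (i0 : I)
    (A : I -> 'M[C]_#|X|) :
  comm_assoc_scheme i0 A ->
  exists col : 'I_#|X| -> 'I_#|X| -> I, forall i x y, A i x y = (col x y == i)%:R.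
Proof.
move=> schA; pose col x y := odflt i0 [pick i | A i x y == 1].
exists col => i x y.
have sumA : \sum_i A i x y = 1.
  by have /matrixP/(_ x y) := scheme_sum schA; rewrite summxE mxE.
have A01 j : (A j x y == 1) = (A j x y != 0) /\ 0 <= A j x y.
  by case: (scheme_01 schA j x y) => ->; rewrite ?eqxx ?oner_eq0 1?eq_sym ?oner_eq0.
have colP : A (col x y) x y = 1.
  rewrite /col; case: pickP => [j /eqP // | noA].
  move: sumA; rewrite big1 => [/eqP | j _]; first by rewrite eq_sym oner_eq0.
  by apply/eqP; have := noA j; rewrite /= (A01 j).1 => /negbFE.
case: eqVneq => [<- // | neq_i].
move: sumA; rewrite (bigD1 (col x y)) //= colP -[RHS]addr0 => /addrI /eqP.
rewrite psumr_eq0 => [/allP/(_ i) | j _]; last exact: (A01 j).2.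
by rewrite mem_index_enum eq_sym neq_i => /(_ isT)/eqP.
Qed.

(** Collects what the two cases share: [f] translates labels, and [j1] is the idempotent whose
    column of [Q] is 1 on the half classes and -1 elsewhere when column [j0] is constantly 1. *)
Lemma BGW_of_scheme (C : numFieldType) (m v k : nat) (lambda : rat)
    (I J : finType) (i0 : I) (j0 j1 : J) (P : J -> I -> C) (Q : I -> J -> C)
    (f : I -> adj2 m.+1) (a0 a2 : 'I_m.+1 -> I) (a1 : I) :
    (0 < v)%N -> j0 != j1 -> a0 0 = i0 -> injective f ->
    (forall g, f (a0 g) = A2_0 g) -> (forall g, f (a2 g) = A2_2 g) -> f a1 = A2_1 ->
    (forall g h e, P e (a0 g) * P e (a0 h) = P e (a0 (g + h))) ->
    (forall g h e, P e (a2 g) * P e (a0 h) = P e (a2 (g + h))) ->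
    (forall g e, P e (a2 g) * P e (a2 0) =
       k%:R * P e (a0 g) + ratr (lambda / m.+1%:R) * P e a1) ->
    (forall g, P j0 (a0 g) = 1) -> (forall g, P j0 (a2 g) = k%:R) ->
    \sum_i P j0 i = ((v * m.+1).*2)%:R ->
    (forall i, Q i j0 + Q i j1 = 2 * (half_class (f i))%:R) ->
    has_scheme_with_eigenmatrices i0 j0 P Q ->
  exists W : 'M[option 'I_m.+1]_v, is_BGW k lambda W.
Proof.
move=> v_gt0 neq_j a00 f_inj fa0 fa2 fa1 P00 P20 P22 Pj0 Pj2 sumP QT.
case=> X [A [E [schA idE eigP eigQ]]].
have [col colA] := scheme_coloring schA.
pose fcol x y := f (col x y).
have relA a i : f i = a -> relmx C (color_rel fcol a) = A i.
  by move=> <-; apply/matrixP => x y; rewrite mxE colA /color_rel (inj_eq f_inj).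
have relA0 g := relA _ _ (fa0 g); have relA2 g := relA _ _ (fa2 g).
have cardX : #|X| = (v * m.+1).*2.
  apply/eqP; rewrite -(eqr_nat C) -sumP.
  by rewrite (card_points_first_row schA idE eigP).
have n2 : 2 != 0 :> C by rewrite pnatr_eq0.
have eT : \sum_l (Q l j0 + Q l j1) *: A l = 2 *: relmx C (half_rel fcol).
  apply/matrixP => x y; rewrite summxE (bigD1 (col x y)) //= big1 => [|l neq_l].
    by rewrite !mxE colA eqxx mulr1 addr0 QT.
  by rewrite mxE colA eq_sym (negPf neq_l) mulr0.
have halfX : #|X|%:R / 2 = (v * m.+1)%:R :> C.
  by rewrite cardX -muln2 natrM mulfK.
apply: (@BGW_of_coloring C #|X| m v k lambda fcol) => //.
- by rewrite relA0 a00 (scheme_id schA).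
- by move=> g h; rewrite !relA0; apply: (adj_mul_eq schA idE eigP).
- by move=> g h; rewrite !relA2 relA0; apply: (adj_mul_eq schA idE eigP).
- move=> g; rewrite !relA2 relA0 (relA _ _ fa1).
  exact: (adj_mul_eq2 schA idE eigP).
- by move=> g; rewrite relA0 (adj_mul_const schA idE eigP) Pj0 scale1r.
- by move=> g; rewrite relA2 (adj_mul_const schA idE eigP) Pj2.
- by rewrite (idem_pair_square schA idE eigQ neq_j n2 eT) halfX.
by rewrite (idem_pair_const schA idE eigQ neq_j n2 eT) halfX.
Qed.

(** * Arithmetic of the entries of the eigenmatrices *)

Section RootOfUnity.
Variables (R : realType) (n : nat).

(** De Moivre's formula, from the addition formulas. *)
Lemma root_unity_power j : root_unity R n ^+ j =
  Complex (cos (2 * pi / n%:R *+ j)) (sin (2 * pi / n%:R *+ j)).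
Proof.
elim: j => [|j IHj]; first by rewrite expr0 mulr0n cos0 sin0.
rewrite exprSr IHj (mulrSr (2 * pi / n%:R)) cosD sinD /root_unity.
by apply/eqP; rewrite eq_complex /= eqxx /= addrC.
Qed.

Lemma root_unity_expn : (0 < n)%N -> root_unity R n ^+ n = 1.
Proof.
move=> n_gt0; rewrite root_unity_power -mulr_natr divfK; last first.
  by rewrite pnatr_eq0 -lt0n.
by rewrite mulrC mulr_natr cos2pi sin2pi.
Qed.

End RootOfUnity.

(** The sum [g + h] in the cyclic group is reduced modulo [m.+1], which does not affect powers of
    [w]. *)
Lemma expV_ordD (C : fieldType) (m : nat) (w : C) (g h : 'I_m.+1) (j : nat) :
  w ^+ m.+1 = 1 -> w ^- (g * j) * w ^- (h * j) = w ^- ((g + h)%R * j).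
Proof.
move=> wn; rewrite -invfM -exprD -mulnDl; congr _^-1.
rewrite mulnC [in RHS]mulnC !(mulnC j) !exprM; congr (_ ^+ _).
by rewrite -(expr_mod (g + h)%N wn).
Qed.

Lemma rsqrt_mul (R : realType) (x : R) :
  0 <= x -> (Num.sqrt x)%:C%C * (Num.sqrt x)%:C%C = x%:C%C.
Proof. by move=> x_ge0; rewrite -rmorphM -expr2 sqr_sqrtr. Qed.

Lemma big_adj1 (V : nmodType) n (F : Defs.adj1 n -> V) :
  \sum_a F a = \sum_i F (A1_0 i) + F A1_1 + \sum_i F (A1_2 i).
Proof.
rewrite (reindex (@adj1_decode n)); last first.
  by exists (@adj1_code n) => [[[i|[]]|i]|a] // _; apply: adj1_codeK.
by rewrite !big_sumType /= (big_pred1 tt) // => -[].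
Qed.

Lemma big_adj2 (V : nmodType) n (F : adj2 n -> V) :
  \sum_a F a = \sum_i F (A2_0 i) + (F A2_1 + F A2_3) + \sum_i F (A2_2 i).
Proof.
rewrite (reindex (@adj2_decode n)); last first.
  by exists (@adj2_code n) => [[[i|[]]|i]|a] // _; apply: adj2_codeK.
by rewrite !big_sumType /= big_bool.
Qed.

(** This is [k^2 = k + lambda (v - 1)], needed on the rows with eigenvalues [k] and [- k]. *)
Lemma valency_sq_eq (C : numFieldType) (n v k : C) : n != 0 -> v - 1 != 0 ->
  k * k = k * 1 + k * (k - 1) / (v - 1) / n * (n * (v - 1)).
Proof. by move=> n0 v0; field; rewrite n0 v0. Qed.

(** Here both sides are [k - lambda], the square of the eigenvalue of [A_{2,0}] on the rows where
    [A_1] has eigenvalue [- n]. *)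
Lemma restricted_eigenvalue_sq_eq (C : numFieldType) (n v k : C) :
  n != 0 -> v - 1 != 0 ->
  k * (v - k) / (v - 1) = k * 1 + k * (k - 1) / (v - 1) / n * - n.
Proof. by move=> n0 v0; field; rewrite n0 v0. Qed.

(** * Verification of the row identities for the two pairs of eigenmatrices *)

Theorem theorem10 (R : realType) (n v k : nat)
  (n_gt0 : (0 < n)%N) (k_gt0 : (0 < k)%N) (v_ge2 : (2 <= v)%N) (k_le_v : (k <= v)%N)
  (scheme :
    (k = v /\
     has_scheme_with_eigenmatrices (A1_0 (Ordinal n_gt0)) E1_0
       (@P1 R n v k) (@Q1 R n v k)) \/
    ((k < v)%N /\
     has_scheme_with_eigenmatrices (A2_0 (Ordinal n_gt0)) E2_0
       (@P2 R n v k) (@Q2 R n v k))) :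
  exists W : 'M[option (cyclicZ n)]_v,
    is_BGW k (k%:R * (k%:R - 1) / (v%:R - 1)) W.
Proof.
case: n n_gt0 scheme => // m n_gt0 scheme.
have v_gt0 : (0 < v)%N by apply: ltnW.
have wD := expV_ordD _ _ _ (root_unity_expn R n_gt0).
have n0 : m.+1%:R != 0 :> R[i] by rewrite pnatr_eq0.
have v1 (K : numFieldType) : v%:R - 1 = v.-1%:R :> K.
  by rewrite -subn1 natrB.
have v10 (K : numFieldType) : v%:R - 1 != 0 :> K.
  by rewrite v1 pnatr_eq0 -lt0n -subn1 subn_gt0.
have sqk : (Num.sqrt (k%:R : R))%:C%C * (Num.sqrt (k%:R : R))%:C%C = k%:R.
  by rewrite rsqrt_mul ?ler0n // rmorph_nat.
have ratl : ratr (k%:R * (k%:R - 1) / (v%:R - 1) / m.+1%:R) =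
    k%:R * (k%:R - 1) / (v%:R - 1) / m.+1%:R :> R[i].
  by rewrite !fmorph_div rmorphM !rmorphB !rmorph_nat rmorph1.
case: scheme => [[eq_kv] | [lt_kv]].
  pose f (a : Defs.adj1 m.+1) : adj2 m.+1 :=
    match a with A1_0 g => A2_0 g | A1_1 => A2_1 | A1_2 g => A2_2 g end.
  apply: (@BGW_of_scheme _ _ _ _ _ _ _ _ _ E1_1 _ _ f (@A1_0 _) (@A1_2 _) A1_1) => //.
  - by apply/eqP.
  - by congr A1_0; apply: val_inj.
  - by move=> [g||g] [h||h] //= [->].
  - by move=> g h [|||j|j] /=; rewrite ?mulr1.
  - by move=> g h [|||j|j] /=; rewrite ?mulr1 ?mul0r // -mulrA wD.
  - move=> g [|||j|j] /=; rewrite ratl.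
    + exact: valency_sq_eq n0 (v10 _).
    + by rewrite mulrNN; exact: valency_sq_eq n0 (v10 _).
    (* For [k = v] the value [k (v - k) / (v - 1)] is 0, matching the zero eigenvalue on [E1_2]. *)
    + by rewrite -(restricted_eigenvalue_sq_eq _ n0 (v10 _)) eq_kv subrr !mulr0 mul0r.
    + by rewrite mulr0 addr0 mul0n expr0 invr1 mulr1 mulrAC sqk.
    + by rewrite mulr0 addr0 mul0n expr0 invr1 mulr1 mulrAC mulrNN sqk.
  (* The valencies sum to [n + n (v - 1) + n k], which is [2 v n] because [k = v]. *)
  - rewrite big_adj1 /= !sumr_const card_ord eq_kv v1 -natrM -mulrnA -!natrD.
    by congr _%:R; rewrite -addnn; case: (v) v_gt0 => // u _; rewrite /=; lia.
  - by move=> [g||g] /=; rewrite ?subrr ?mulr0 ?mulr1.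
apply: (@BGW_of_scheme _ _ _ _ _ _ _ _ _ E2_1 _ _ id (@A2_0 _) (@A2_2 _) A2_1) => //.
- by apply/eqP.
- by congr A2_0; apply: val_inj.
- by move=> g h [||||j|j] /=; rewrite ?mulr1.
- by move=> g h [||||j|j] /=; rewrite ?mulr1 // -mulrA wD.
- have sq2 : (Num.sqrt (k%:R * (v%:R - k%:R) / (v%:R - 1) : R))%:C%C *
      (Num.sqrt (k%:R * (v%:R - k%:R) / (v%:R - 1) : R))%:C%C =
      k%:R * (v%:R - k%:R) / (v%:R - 1) :> R[i].
    rewrite rsqrt_mul; first by rewrite fmorph_div rmorphM !rmorphB !rmorph_nat rmorph1.
    by rewrite v1 -natrB // divr_ge0 ?mulr_ge0 ?ler0n.
  move=> g [||||j|j] /=; rewrite ratl.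
  + exact: valency_sq_eq n0 (v10 _).
  + by rewrite mulrNN; exact: valency_sq_eq n0 (v10 _).
  + by rewrite sq2; exact: restricted_eigenvalue_sq_eq n0 (v10 _).
  + by rewrite mulrNN sq2; exact: restricted_eigenvalue_sq_eq n0 (v10 _).
  + by rewrite mulr0 addr0 mul0n expr0 invr1 mulr1 mulrAC sqk.
  + by rewrite mulr0 addr0 mul0n expr0 invr1 mulr1 mulrAC mulrNN sqk.
(* Here [n + n (v - 1) + n (v - k) + n k = 2 v n]. *)
- rewrite big_adj2 /= !sumr_const card_ord v1 -natrB // -!natrM -mulrnA -!natrD.
  congr _%:R; rewrite -addnn; have := subnKC k_le_v.
  by case: (v) v_gt0 => // u _; rewrite /=; nia.
- by move=> [g||g|] /=; rewrite ?subrr ?mulr0 ?mulr1.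
Qed.
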